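(* Let $A$ be a finite dimensional associative (not necessarily unital) $\mathbb C$-algebra with a distinguished basis $B$. Then the paratrophic determinant $\theta_{(A,B)}\in\mathbb C[X_B]$ is nonzero if and only if $A$ is a Frobenius algebra (and, in particular, unital).
   Context: Algebras are associative over $\mathbb C$ and are not assumed to have an identity. Structure constants $c_{b'',b,b'}\in\mathbb C$ of $(A,B)$ are defined by $bb'=\sum_{b''\in B}c_{b'',b,b'}b''$ for $b,b'\in B$. Let $X_B=\{x_b\mid b\in B\}$ be a set of variables. The Cayley table $C(A,B)$ is the $B\times B$ matrix over $\mathbb C[X_B]$ with entries $C(A,B)_{b,b'}=\sum_{b''\in B}c_{b'',b,b'}x_{b''}$, and the paratrophic determinant is $\theta_{(A,B)}=\det C(A,B)$. A finite dimensional $K$-algebra $A$ is Frobenius if it is unital and there is a linear map $\lambda\colon A\to K$ such that the bilinear form $(a,b)\mapsto\lambda(ab)$ is nondegenerate. *)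

(* Defs.v *)
From HB Require Import structures.
From mathcomp Require Import all_boot all_order all_algebra.
From mathcomp Require Import complex mpoly reals.

Set Implicit Arguments.
Unset Strict Implicit.
Unset Printing Implicit Defensive.

Import GRing.Theory.
Local Open Scope ring_scope.

(* MathComp's algebra structures are all unital, so a possibly non-unital      *)
(* algebra is given by a vector space A together with a bilinear product mul;  *)
(* associativity of mul is assumed where it is needed. A distinguished basis   *)
(* is enumerated as an n-tuple B, and x_b, for b the i-th element of B, is     *)
(* the polynomial variable 'X_i.                                               *)

Section Paratrophic.
Variables (K : fieldType) (A : vectType K) (mul : {bilinear A -> A -> A}).
Variables (n : nat) (B : n.-tuple A).

Definition structure_const (k i j : 'I_n) : K := coord B k (mul B`_i B`_j).

Lemma structure_constE (i j : 'I_n) : basis_of fullv B ->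
  mul B`_i B`_j = \sum_(k < n) structure_const k i j *: B`_k.
Proof. by move=> basisB; apply: coord_basis basisB (memvf _). Qed.

Definition cayley_table : 'M[{mpoly K[n]}]_n :=
  \matrix_(i < n, j < n) \sum_(k < n) structure_const k i j *: 'X_k.

Definition paratrophic_det : {mpoly K[n]} := \det cayley_table.

End Paratrophic.

Section Frobenius.
Variables (K : fieldType) (A : vectType K).

Definition unital (mul : A -> A -> A) : Prop :=
  exists e : A, left_id e mul /\ right_id e mul.

(* The library's nondegenerate only covers (skew-)hermitian forms, whereas     *)
(* the form below need not be symmetric; both radicals are required to vanish. *)
Definition nondegenerate_form (f : A -> A -> K) : Prop :=
  (forall a, (forall b, f a b = 0) -> a = 0) /\
  (forall b, (forall a, f a b = 0) -> b = 0).

Definition frobenius (mul : {bilinear A -> A -> A}) : Prop :=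
  unital mul /\
  exists lambda : {scalar A}, nondegenerate_form (fun a b => lambda (mul a b)).

End Frobenius.

(* Main.v *)
Require Import Defs.
From HB Require Import structures.
From mathcomp Require Import all_boot all_order all_algebra.
From mathcomp Require Import complex mpoly reals.
From mathcomp Require Import boolp.

Set Implicit Arguments.
Unset Strict Implicit.
Unset Printing Implicit Defensive.

Import GRing.Theory.
Local Open Scope ring_scope.

(* Substituting numbers v_b for the variables turns the Cayley table into the *)
(* Gram matrix of (a, b) |-> lambda (ab), where lambda is the functional with *)
(* lambda b = v_b; so the determinant is a nonzero polynomial if and only if  *)
(* one of these forms is nondegenerate. In that case some e represents lambda *)
(* itself, lambda (eb) = lambda b for all b; then                             *)
(* lambda ((ea - a)b) = lambda (e(ab)) - lambda (ab) = 0, so e is a left      *)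
(* identity. A right identity exists by symmetry, and the two coincide.       *)

(** Two facts link the polynomial to forms. [meval_paratrophic_det] and [gram_unitmx] identify a
    nonzero value of the determinant with nondegeneracy of a form, every point arising from a
    functional by [coord_form]. [mpoly_meval_eq0] supplies such a point: over an infinite domain
    only the zero polynomial vanishes everywhere. The identity then comes from [gram_repr] and
    [nondegenerate_unital]. *)

(** The sequence [u] witnesses that [R] is infinite: its first [size p] terms would be too many
    roots for a nonzero [p]. *)
Lemma poly_horner_eq0 (R : idomainType) (u : nat -> R) (p : {poly R}) :
  injective u -> (forall x, p.[x] = 0) -> p = 0.
Proof.
move=> u_inj p0; apply/eqP/negP => /negP p_neq0.
suff: (size (map u (iota 0 (size p))) < size p)%N.
  by rewrite size_map size_iota ltnn.
apply: max_poly_roots p_neq0 _ _; last by rewrite map_inj_uniq ?iota_uniq.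
by apply/allP => x _; apply/eqP/p0.
Qed.

Section Muni.
Variables (n : nat) (R : comNzRingType).
Implicit Type p : {mpoly R[n.+1]}.

Lemma widen_ord_lift (i : 'I_n) : widen_ord (leqnSn n) i = lift ord_max i.
Proof. by apply/val_inj; rewrite /= /bump leqNgt ltn_ord. Qed.

(** [muni] singles out the last variable, so a monomial splits into its last exponent and the
    remaining ones; hence [muni] loses no coefficient. *)
Lemma coef_muni p (m : 'X_{1..n.+1}) :
  ((muni p)`_(m ord_max))@_[multinom m (widen_ord (leqnSn n) i) | i < n]
  = p@_m.
Proof.
rewrite muniE coef_sum raddf_sum /= [in RHS](mpolyE p) raddf_sum /=.
apply: eq_bigr => m' _; rewrite coefZ coefXn mcoeffZ mcoeffX.
have -> : (m' == m) = ([multinom m' (widen_ord (leqnSn n) i) | i < n]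
    == [multinom m (widen_ord (leqnSn n) i) | i < n])
    && (m ord_max == m' ord_max).
  apply/eqP/andP => [->|[/eqP/mnmP eqw /eqP eqmax]]; first by rewrite !eqxx.
  apply/mnmP => i; case: (unliftP ord_max i) => [j|] -> //.
  by have := eqw j; rewrite !mnmE widen_ord_lift.
by case: (m ord_max == _); rewrite ?andbT ?andbF ?mulr1 ?mulr0 ?mcoeff0 //
  mcoeffZ mcoeffX.
Qed.

Lemma muni_eq0 p : muni p = 0 -> p = 0.
Proof.
by move=> p0; apply/mpolyP => m; rewrite -coef_muni p0 coef0 !mcoeff0.
Qed.

Lemma horner_muni p (v : 'I_n -> R) (x : R) :
  (map_poly (meval v) (muni p)).[x]
  = p.@[fun i => if unlift ord_max i is Some j then v j else x].
Proof.
rewrite muniE mevalE rmorph_sum horner_sum; apply: eq_bigr => m _.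
rewrite -!mul_polyC !rmorphM /= !map_polyC /= map_polyXn hornerE hornerXn.
rewrite mevalZ mevalX -mulrA big_ord_recr /= unlift_none.
congr (_ * (_ * _)); apply: eq_bigr => i _.
by rewrite widen_ord_lift liftK mnmE widen_ord_lift.
Qed.

End Muni.

(** Induction on the number of variables: with the other variables fixed at [v], a polynomial in the
    last one vanishes everywhere, so each coefficient of [muni p] vanishes at every [v]. *)
Lemma mpoly_meval_eq0 (R : idomainType) (u : nat -> R) n (p : {mpoly R[n]}) :
  injective u -> (forall v, p.@[v] = 0) -> p = 0.
Proof.
move=> u_inj; elim: n p => [|n IHn] p p0.
  by have := p0 (fun=> 0); rewrite [p]nvar0_mpolyC mevalC => ->.
apply: muni_eq0; apply/polyP => k; rewrite coef0; apply: IHn => v.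
rewrite -coef_map (@poly_horner_eq0 _ u (map_poly _ _)) ?coef0 // => x.
by rewrite horner_muni p0.
Qed.

Section Gram.
Variables (K : fieldType) (A : vectType K) (mul : {bilinear A -> A -> A}).
Variables (n : nat) (B : n.-tuple A).
Hypothesis basisB : basis_of fullv B.
Implicit Types (lambda : {scalar A}) (a b : A) (u : 'rV[K]_n).

Let vec u : A := \sum_i u 0 i *: B`_i.

Let coordB a : a = \sum_i coord B i a *: B`_i.
Proof. exact: coord_basis basisB (memvf a). Qed.

Let vec_eq0 u : vec u = 0 -> u = 0.
Proof.
move=> u0; apply/rowP => i.
rewrite mxE -(coord_sum_free (u 0) i (basis_free basisB)).
by rewrite -/(vec u) u0 linear0.
Qed.

Definition gram lambda : 'M[K]_n := \matrix_(i, j) lambda (mul B`_i B`_j).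

(** Evaluation is a ring morphism, so it commutes with the determinant; on entries, it is linearity
    of [lambda]. *)
Lemma meval_paratrophic_det lambda :
  (paratrophic_det mul B).@[fun k : 'I_n => lambda B`_k] = \det (gram lambda).
Proof.
rewrite -det_map_mx; congr (\det _); apply/matrixP => i j.
rewrite !mxE structure_constE // raddf_sum linear_sum /=.
by apply: eq_bigr => k _; rewrite !linearZ /= mevalXU.
Qed.

Lemma mul_vecl lambda u (j : 'I_n) :
  lambda (mul (vec u) B`_j) = (u *m gram lambda) 0 j.
Proof.
rewrite linear_sumlz !linear_sum mxE.
by apply: eq_bigr => i _; rewrite linearZl_LR linearZ mxE.
Qed.

Lemma mul_vecr lambda u (i : 'I_n) :
  lambda (mul B`_i (vec u)) = (u *m (gram lambda)^T) 0 i.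
Proof.
rewrite !linear_sum mxE.
by apply: eq_bigr => j _; rewrite !linearZ !mxE.
Qed.

(** In coordinates, the two radicals are the row kernels of the Gram matrix and of its transpose. *)
Lemma gram_unitmx lambda :
  nondegenerate_form (fun a b => lambda (mul a b)) <->
  gram lambda \in unitmx.
Proof.
split=> [[lnd _]|unitG].
  rewrite unitmxE unitfE; apply/det0P => -[u /eqP u_neq0 uG0]; apply: u_neq0.
  apply/vec_eq0/lnd => b; rewrite (coordB b) !linear_sum big1 // => j _.
  by rewrite !linearZ /= mul_vecl uG0 mxE mulr0.
split=> a a0; rewrite (coordB a).
  have /eqP : (\row_i coord B i a) *m gram lambda = 0.
    apply/rowP => j; rewrite -mul_vecl mxE -[RHS](a0 B`_j) [in RHS](coordB a).
    by congr (lambda (mul _ _)); apply: eq_bigr => i _; rewrite mxE.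
  rewrite mulmx_free_eq0 ?row_free_unit // => /eqP /rowP u0.
  by rewrite big1 // => i _; have := u0 i; rewrite !mxE => ->; rewrite scale0r.
have /eqP : (\row_i coord B i a) *m (gram lambda)^T = 0.
  apply/rowP => j; rewrite -mul_vecr mxE -[RHS](a0 B`_j) [in RHS](coordB a).
  by congr (lambda (mul _ _)); apply: eq_bigr => i _; rewrite mxE.
rewrite mulmx_free_eq0 ?row_free_unit ?unitmx_tr // => /eqP /rowP u0.
by rewrite big1 // => i _; have := u0 i; rewrite !mxE => ->; rewrite scale0r.
Qed.

Lemma gram_repr lambda : gram lambda \in unitmx ->
  (exists e, forall a, lambda (mul e a) = lambda a) /\
  (exists e, forall a, lambda (mul a e) = lambda a).
Proof.
(* The row [l] represents [lambda]; the coordinates of [e] solve [u *m G = l] on the left side and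
   [u *m G^T = l] on the right, with [G] the Gram matrix. *)
move=> unitG; pose l : 'rV[K]_n := \row_j lambda B`_j; split.
  exists (vec (l *m invmx (gram lambda))) => a.
  rewrite (coordB a) !linear_sum; apply: eq_bigr => j _.
  by rewrite !linearZ mul_vecl mulmxKV // mxE.
exists (vec (l *m invmx (gram lambda)^T)) => a.
rewrite (coordB a) linear_sumlz !linear_sum; apply: eq_bigr => j _.
by rewrite linearZl_LR !linearZ mul_vecr mulmxKV ?unitmx_tr // mxE.
Qed.

Definition coord_form (v : 'I_n -> K) a : K := \sum_k coord B k a * v k.

Lemma coord_form_is_scalar v : scalar (coord_form v).
Proof.
move=> c a b; rewrite /coord_form mulr_sumr -big_split; apply: eq_bigr => k _.
by rewrite linearP mulrDl -mulrA.
Qed.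

HB.instance Definition _ v := GRing.isLinear.Build K A K *%R (coord_form v)
  (coord_form_is_scalar v).

Lemma coord_form_basis v (k : 'I_n) : coord_form v B`_k = v k.
Proof.
rewrite /coord_form (bigD1 k) //= coord_free ?(basis_free basisB) // eqxx mul1r.
rewrite big1 ?addr0 // => i /negbTE neq_ik.
by rewrite coord_free ?(basis_free basisB) // eq_sym neq_ik mul0r.
Qed.

End Gram.

Lemma nondegenerate_unital (K : fieldType) (A : vectType K)
    (mul : {bilinear A -> A -> A}) (lambda : {scalar A}) (el er : A) :
  associative mul -> nondegenerate_form (fun a b => lambda (mul a b)) ->
  (forall a, lambda (mul el a) = lambda a) ->
  (forall a, lambda (mul a er) = lambda a) -> unital mul.
Proof.
move=> mulA [lnd rnd] lamel lamer.
have lid : left_id el mul.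
  move=> a; apply/eqP; rewrite -subr_eq0; apply/eqP/lnd => b.
  by rewrite linearBl linearB /= -mulA lamel subrr.
have rid : right_id er mul.
  move=> a; apply/eqP; rewrite -subr_eq0; apply/eqP/rnd => b.
  by rewrite linearBr linearB /= mulA lamer subrr.
(* Here [a el = a (el er) = a er = a]. *)
by exists el; split=> // a; rewrite -{1}[el]rid lid rid.
Qed.

Theorem theorem2p1 (R : realType) (A : vectType R[i])
    (mul : {bilinear A -> A -> A}) (mulA : associative mul)
    (n : nat) (B : n.-tuple A) (basisB : basis_of fullv B) :
  paratrophic_det mul B <> 0 <-> frobenius mul.
Proof.
split=> [theta_neq0|]; last first.
  case=> _ [lambda /(gram_unitmx mul basisB) unitG] theta0; move: unitG.
  rewrite unitmxE -(meval_paratrophic_det mul basisB) theta0.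
  by rewrite meval0 unitr0.
(* Characteristic zero provides infinitely many distinct scalars. *)
have natr_inj : injective (fun k : nat => k%:R : R[i]).
  by move=> k l /eqP; rewrite Num.Theory.eqr_nat => /eqP.
have [v thetav] : exists v, (paratrophic_det mul B).@[v] != 0.
  apply: contrapT => thetav; apply: theta_neq0.
  apply: (mpoly_meval_eq0 natr_inj) => v; apply: contrapT => /eqP vneq0.
  by apply: thetav; exists v.
pose lambda : {scalar A} := coord_form B v.
have unitG : gram mul B lambda \in unitmx.
  rewrite unitmxE unitfE -(meval_paratrophic_det mul basisB).
  by rewrite (meval_eq _ (coord_form_basis basisB v)).
have lambda_nd := (gram_unitmx mul basisB _).2 unitG.
have [[el lamel] [er lamer]] := gram_repr basisB unitG.
by split; [exact: nondegenerate_unital lamel lamer|exists lambda].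
Qed.
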